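(* There is an absolute constant $C>0$ such that for every $\sigma\ge 1$, every $n\ge 1$ and every string $w$ of length $n$ over $\Sigma=\{1,\dots,\sigma\}$, the number of occurrences of order-preserving squares in $w$ is at most $C\sigma n$. Here an occurrence is a pair $(i,\ell)$ with $\ell\ge 1$, $i\ge 1$, $i+2\ell-1\le n$ such that $w[i..i+2\ell-1]$ is an order-preserving square. Moreover, this bound is asymptotically tight even if only order-preserving squares that are distinct as words are counted: there is an absolute constant $c>0$ such that for every $\sigma\ge 1$ there are infinitely many $n$ and strings $w$ of length $n$ over $\{1,\dots,\sigma\}$ having at least $c\sigma n$ pairwise distinct words $x$ each of which is an order-preserving square and occurs as a fragment of $w$.
   Context: Strings are finite sequences over the ordered alphabet $\Sigma=\{1,\dots,\sigma\}$ and are indexed from $1$. For a string $s$, $s[i]$ is its $i$-th character and $s[i..j]$ is the fragment from position $i$ to position $j$. Two strings $u,v$ are order-isomorphic, written $u\approx v$, if $|u|=|v|$ and for all $i,j$ we have $u[i]\le u[j]$ if and only if $v[i]\le v[j]$. An order-preserving square is a string of the form $uv$ with $u\approx v$ and $u\neq v$. In particular, a square $xx$ is not an order-preserving square.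
   Formalization: The tightness clause is stated for σ ≥ 2 instead of σ ≥ 1: over a one-letter alphabet |u| = |v| forces u = v, so no order-preserving square exists and the bound cσn with c > 0 fails for σ = 1. *)

(* Defs.v *)
From mathcomp Require Import all_boot all_order all_algebra.

Set Implicit Arguments.
Unset Strict Implicit.
Unset Printing Implicit Defensive.

Import Order.TTheory GRing.Theory Num.Theory.

(* Strings are sequences of naturals; [over_alphabet sigma w] says that all characters
   of w lie in the ordered alphabet {1, ..., sigma}. *)
Definition over_alphabet (sigma : nat) (w : seq nat) : bool :=
  all (fun a => 1 <= a <= sigma) w.

(* The fragment s[i..j], with positions counted from 1. *)
Definition fragment (s : seq nat) (i j : nat) : seq nat :=
  take (j - i).+1 (drop i.-1 s).

Definition order_iso (u v : seq nat) : bool :=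
  (size u == size v) &&
  [forall i : 'I_(size u), forall j : 'I_(size u),
     (nth 0 u i <= nth 0 u j) == (nth 0 v i <= nth 0 v j)].

Lemma order_isoP (u v : seq nat) :
  reflect (size u = size v /\
           forall i j, i < size u -> j < size u ->
             (nth 0 u i <= nth 0 u j <-> nth 0 v i <= nth 0 v j))
          (order_iso u v).
Proof.
apply: (iffP andP) => [[/eqP suv /forallP uv]|[suv uv]]; split.
- exact: suv.
- move=> i j ltiu ltju.
  by have /forallP/(_ (Ordinal ltju))/eqP /= -> := uv (Ordinal ltiu).
- exact/eqP.
- apply/forallP => i; apply/forallP => j; apply/eqP.
  by apply/idP/idP; apply uv; exact: ltn_ord.
Qed.

(* Every factorisation x = u ++ v is of the form u = take k x, v = drop k x. *)
Definition op_square (x : seq nat) : bool :=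
  [exists k : 'I_(size x).+1,
     order_iso (take k x) (drop k x) && (take k x != drop k x)].

Lemma op_squareP (x : seq nat) :
  reflect (exists u v, [/\ x = u ++ v, order_iso u v & u <> v]) (op_square x).
Proof.
apply: (iffP existsP) => [[k /andP[uv /eqP neq]]|[u [v [-> uv neq]]]].
  by exists (take k x), (drop k x); rewrite cat_take_drop.
have ltk : size u < (size (u ++ v)).+1 by rewrite ltnS size_cat leq_addr.
exists (Ordinal ltk) => /=; rewrite take_size_cat // drop_size_cat // uv.
exact/eqP.
Qed.

Definition op_square_occurrence (w : seq nat) (i l : nat) : bool :=
  [&& 1 <= l, 1 <= i, i + 2 * l - 1 <= size w
    & op_square (fragment w i (i + 2 * l - 1))].

(* Any occurrence (i, l) has i <= size w and l <= size w, so the ordinals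
   below range over all of them. *)
Definition num_op_square_occurrences (w : seq nat) : nat :=
  #|[set p : 'I_(size w).+1 * 'I_(size w).+1 | op_square_occurrence w p.1 p.2]|.

(* A one-letter alphabet admits no order-preserving square at all, so a lower
   bound c * sigma * n with c > 0 can only hold for sigma >= 2. *)
Lemma over1_not_op_square (x : seq nat) : over_alphabet 1 x -> ~~ op_square x.
Proof.
move=> ox; apply/negP => /op_squareP[u [v [xE /andP[/eqP suv _] neq]]].
have eq1 s : over_alphabet 1 s -> s = nseq (size s) 1.
  move=> os; apply/all_pred1P; apply: sub_all os => a /=.
  by rewrite -eqn_leq eq_sym.
move: ox; rewrite xE /over_alphabet all_cat => /andP[/eq1 uE /eq1 vE].
by apply: neq; rewrite uE vE suv.
Qed.

(* Main.v *)
Require Import Defs.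
From mathcomp Require Import all_boot all_order all_algebra zify.

(* Upper bound. Fix a starting position and read the word from there. Let F be
   the set of positions at which a letter occurs for the first time, so
   |F| <= sigma, and L the set of half-lengths l of the order-preserving squares
   uv that start there. Since u <> v, some letter of v does not occur in u: F
   meets [l, 2l[, and the isomorphism sends an element a of F in [l, 2l[ to
   a - l, again in F. Two elements l1 < l2 of L in the same gap of F make the
   prefix of length l1 order-periodic with period p = l2 - l1. This shift maps F
   to itself below l1, and F must meet [l1 - p, l1[, as otherwise the prefix is
   genuinely periodic and a - l1 is not a first occurrence. Hence the distances
   from the elements of L in a gap to its left end y at least double, and F is
   dense just before y compared with the length of the gap. All but two elements
   of L in each gap can then be charged injectively to elements of F, so
   |L| <= 3 |F|.

   Lower bound. In 1^m 2^m ... sigma^m, two consecutive fragments of length k m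
   differ by the translation by k. For sigma = 2 this leaves too few squares, and
   1^x 2^x for x <= m is used instead. *)

Set Implicit Arguments.
Unset Strict Implicit.
Unset Printing Implicit Defensive.

(** * Counting in gap systems *)

Lemma leq_size_injective_rel (T U : eqType) (P : T -> U -> Prop)
    (s : seq T) (t : seq U) :
  uniq s ->
  (forall x, x \in s -> exists2 y, y \in t & P x y) ->
  (forall x x' y, P x y -> P x' y -> x = x') ->
  size s <= size t.
Proof.
move=> us ex inj; elim: s t us ex => //= x s IHs t /andP[xs us] ex.
have [y yt Pxy] := ex x (mem_head x s).
have := IHs (rem y t) us; rewrite size_rem //.
have t_gt0 : 0 < size t by case: (t) yt.
rewrite -[in X in _ -> _ < X](prednK t_gt0) ltnS; apply => x' x's.
have [|y' y't Px'y'] := ex x'; first by rewrite inE x's orbT.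
exists y' => //; move: y't; rewrite (perm_mem (perm_to_rem yt)) inE.
case/predU1P => // y'y; rewrite y'y in Px'y'.
by rewrite (inj _ _ _ Pxy Px'y') x's in xs.
Qed.

(** All that the count needs about words: [F] stands for the first occurrences and [L] for the
    half-lengths of squares, both read from a fixed start. *)
Record gap_system (F L : pred nat) : Prop := GapSystem {
  gap0 : F 0;
  gap_pos : forall l, L l -> 0 < l;
  gap_ex : forall l, L l -> exists2 a, F a & l <= a < 2 * l;
  gap_sub : forall l a, L l -> F a -> l <= a < 2 * l -> F (a - l);
  gap_shift : forall l1 l2 f, L l1 -> L l2 -> l1 < l2 -> F f ->
    l2 - l1 <= f < l1 -> F (f - (l2 - l1));
  gap_near : forall l1 l2 a, L l1 -> L l2 -> l1 < l2 -> F a ->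
    l2 <= a < 2 * l1 -> exists2 f, F f & l1 - (l2 - l1) <= f < l1 }.

Definition last_below (F : pred nat) (y l : nat) : Prop :=
  [/\ F y, y < l & forall f, F f -> f < l -> f <= y].

Definition first_two (L : pred nat) (y l1 l2 : nat) : Prop :=
  [/\ L l1, L l2, y < l1 < l2 & forall l, L l -> y < l -> l = l1 \/ l2 <= l].

(* [l] is at least the third element of [L] in the gap of [F] that follows [y];
   [l1] and [l2] are the first two. *)
Definition late (F L : pred nat) (y l1 l2 l : nat) : Prop :=
  [/\ last_below F y l, L l, first_two L y l1 l2 & l2 < l].

(* The inequalities here and in [charged] say that [c] lies in [[x, y[],
   respectively [[x, x + 2 * (l2 - l1)]], where [x = y - (l - l1)]. *)
Definition dominates (F L : pred nat) (y c : nat) : Prop :=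
  exists l1 l2 l, [/\ late F L y l1 l2 l, y + l1 <= c + l & c < y].

Definition charged (F L : pred nat) (l c : nat) : Prop :=
  exists y l1 l2, [/\ late F L y l1 l2 l,
    y + l1 <= c + l <= y + l1 + 2 * (l2 - l1),
    c < y & forall y', y' < y -> ~ dominates F L y' c].

Lemma first_two_uniq L y l1 l2 l1' l2' :
  first_two L y l1 l2 -> first_two L y l1' l2' -> l1 = l1' /\ l2 = l2'.
Proof.
move=> [L1 L2 lt12 min12] [L1' L2' lt12' min12'].
move: (min12 _ L1') (min12 _ L2') (min12' _ L1) (min12' _ L2).
lia.
Qed.

Section Gap.
Context (F L : pred nat) (gFL : gap_system F L).

Lemma last_below_ex l : L l -> exists y, last_below F y l.
Proof.
move=> Ll; have exF : exists f, F f && (f < l).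
  by exists 0; rewrite (gap0 gFL) (gap_pos gFL).
have bF f : F f && (f < l) -> f <= l by case/andP => _ /ltnW.
case: (ex_maxnP exF bF) => y /andP[Fy yl] ymax; exists y; split=> // f Ff fl.
by apply: ymax; rewrite Ff.
Qed.

Lemma double_dist y l1 l2 : L l1 -> L l2 -> y < l1 < l2 -> last_below F y l2 ->
  l1 - y <= l2 - l1.
Proof.
move=> L1 L2 /andP[y1 lt12] [Fy yl ymax].
have [a Fa a1] := gap_ex gFL L1.
have a2 : l2 <= a by rewrite leqNgt; apply/negP => /(ymax _ Fa); lia.
have [|f Ff f1] := gap_near gFL L1 L2 lt12 Fa; first by lia.
have := ymax f Ff; lia.
Qed.

(** Some [a] in [F] has [l <= a < 2 * l1], so [a - l1] is in [F] below [l1]. Hence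
    [l - l1 <= a - l1 <= y], and the shift by [l - l1] applies to [y]. *)
Lemma shift_last_below y l1 l : L l1 -> L l -> y < l1 < l -> last_below F y l ->
  exists2 x, F x & x + l = y + l1.
Proof.
move=> L1 Ll /andP[y1 lt1] [Fy yl ymax].
have [a Fa a1] := gap_ex gFL L1.
have a2 : l <= a by rewrite leqNgt; apply/negP => /(ymax _ Fa); lia.
have := ymax _ (gap_sub gFL L1 Fa a1) => le_y.
exists (y - (l - l1)); last by lia.
by apply: (gap_shift gFL) => //; lia.
Qed.

(** Descend from [y] by steps of [l2 - l1], staying in [F], until one more step could reach [c]. *)
Lemma next_close y l1 l2 c : L l1 -> L l2 -> y < l1 < l2 -> F y -> c < y ->
  exists2 f, F f & c < f <= c + (l2 - l1).
Proof.
move=> L1 L2 /andP[y1 lt12]; elim/ltn_ind: y y1 => y IHy y1 Fy cy.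
case: (leqP y (c + (l2 - l1))) => [le_y|lt_y]; first by exists y; rewrite ?cy.
apply: (IHy (y - (l2 - l1))); try lia.
by apply: (gap_shift gFL) => //; lia.
Qed.

Lemma late_dist y l1 l2 l : late F L y l1 l2 l -> 2 * (l2 - y) <= l - y.
Proof.
move=> [lb Ll [L1 L2 lt12 _] lt2].
have := double_dist L2 Ll _ lb; lia.
Qed.

(** Being the least position that dominates [c], [y] is determined by [c]. Then [l] and [l'] lie in
    an interval of length [2 * (l2 - l1)], whereas distinct late elements of a gap differ by at
    least [2 * (l2 - y)]. *)
Lemma charged_inj l l' c : charged F L l c -> charged F L l' c -> l = l'.
Proof.
move=> [y [l1 [l2 [la b cy nd]]]] [y' [l1' [l2' [la' b' cy' nd']]]].
have yy' : y = y'.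
  have d : dominates F L y c by exists l1, l2, l; split=> //; lia.
  have d' : dominates F L y' c by exists l1', l2', l'; split=> //; lia.
  by case: (ltngtP y y') => // [/nd'|/nd].
move: (la) (la') => [lb Ll ft lt2]; rewrite -{}yy' in la' b' *.
move=> [lb' Ll' ft' lt2']; case: (first_two_uniq ft ft') => e1 e2; subst l1' l2'.
have d := late_dist la; have d' := late_dist la'.
case: ft => L1 L2 lt12 _.
case: (ltngtP l l') => // ltll.
  by have := double_dist Ll Ll' _ lb'; lia.
by have := double_dist Ll' Ll _ lb; lia.
Qed.

Lemma next_ex y : F y -> exists nx : nat -> nat, forall c, c < y ->
  [/\ F (nx c), c < nx c <= y & forall f, F f -> c < f -> nx c <= f].
Proof.
move=> Fy.
exists (fun c => val [arg min_(f < ord_max : 'I_y.+1 | F f && (c < f)) val f]).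
move=> c cy; case: arg_minnP => /= [|f /andP[Ff cf] fmin]; first by rewrite Fy.
split=> // [|f' Ff' cf']; first by rewrite cf -ltnS ltn_ord.
case: (leqP f' y) => [f'y|]; last by have := ltn_ord f; lia.
have lt_f' : f' < y.+1 by [].
by apply: (fmin (Ordinal lt_f')); rewrite /= Ff'.
Qed.

Lemma charged_ex y l1 l2 l :
  late F L y l1 l2 l -> exists2 c, F c & c < l /\ charged F L l c.
Proof.
move=> la; have [lb Ll [L1 L2 lt12 min2] lt2] := la.
have [Fy yl ymax] := lb.
have [|x Fx xE] := shift_last_below L1 Ll _ lb; first by lia.
have [nx nxP] := next_ex Fy.
have xy : x < y by lia.
(* Maximising [2 * (nx c - c) - c] keeps [c] close to [x] and forbids any
   dominating [y' < y], because the gap after [y'] is more than twice as long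
   as each gap just before [y']. *)
have [c [Fc xc cy cmax]] : exists c, [/\ F c, x <= c, c < y & forall c', F c' ->
    x <= c' < y -> 2 * nx c' + 3 * c <= 2 * nx c + 3 * c'].
  (* This is the weight above plus [3 * y], which avoids truncated subtraction. *)
  pose V (c : 'I_y) := 2 * nx c + 3 * (y - c).
  have Px : F (Ordinal xy) && (x <= Ordinal xy) by rewrite /= Fx leqnn.
  case: (@arg_maxnP _ (Ordinal xy) (fun c : 'I_y => F c && (x <= c)) V Px).
  move=> c /andP[Fc xc] cmax; have cy := ltn_ord c.
  exists c; split=> // c' Fc' /andP[xc' c'y].
  have := cmax (Ordinal c'y); rewrite /V /= Fc' xc' => /(_ isT); lia.
exists c => //; split; first by lia.
have [Fn cn nmin] := nxP c cy.
exists y, l1, l2; split=> //.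
  (* Since [nx c - c <= l2 - l1], comparing the weights of [c] and [x] gives
     [c - x <= 2 * (l2 - l1)]. *)
  have [f Ff cf] := next_close L1 L2 lt12 Fy cy.
  have := nmin f Ff; have := cmax x Fx; have [_ + _] := nxP x xy; lia.
move=> y' y'y [l1' [l2' [l' [la' b' cy']]]].
have d' := late_dist la'.
have [[Fy' y'l' y'max] Ll' [L1' L2' lt12' _] lt2'] := la'.
have [f Ff cf] := next_close L1' L2' lt12' Fy' cy'.
have [Fn' cn' nmin'] := nxP y' y'y.
(* Here [nx c - c <= l2' - l1'] and [y' - c < nx y' - y'], so maximality of [c] against [y'] gives
   [nx y' - y' < 2 * (l2' - l1')], contradicting [d']. *)
have : l' <= nx y' by rewrite leqNgt; apply/negP => /(y'max _ Fn'); lia.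
have := nmin f Ff; have := cmax y' Fy'; lia.
Qed.

(* The first two elements of [L] in a gap are coded by its left end, the later
   ones by the element of [F] to which they are charged. *)
Definition gap_code (l : nat) (b : nat * nat) : Prop :=
  match b.1 with
  | 0 => last_below F b.2 l /\ forall l', L l' -> b.2 < l' -> l <= l'
  | 1 => last_below F b.2 l /\ exists l1, first_two L b.2 l1 l
  | _ => charged F L l b.2
  end.

Lemma gap_code_inj l l' b : L l -> L l' -> gap_code l b -> gap_code l' b -> l = l'.
Proof.
case: b => -[|[|i]] c Ll Ll' /=; rewrite /gap_code /=.
- move=> [[_ cl _] lmin] [[_ cl' _] l'min].
  by apply/eqP; rewrite eqn_leq lmin // l'min.
- by move=> [_ [l1 ft]] [_ [l1' ft']]; case: (first_two_uniq ft ft').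
- exact: charged_inj.
Qed.

Lemma gap_code_ex l : L l -> exists i c, [/\ i < 3, F c, c < l & gap_code l (i, c)].
Proof.
move=> Ll; have [y lb] := last_below_ex Ll; have [Fy yl ymax] := lb.
have ex1 : exists k, L k && (y < k) by exists l; rewrite Ll.
case: (ex_minnP ex1) => l1 /andP[L1 y1] min1.
have m1 k : L k -> y < k -> l1 <= k by move=> Lk yk; apply: min1; rewrite Lk.
have [ll1|ll1] := leqP l l1.
  exists 0, y; split=> //; split=> //= k Lk yk.
  exact: leq_trans ll1 (m1 _ Lk yk).
have ex2 : exists k, L k && (l1 < k) by exists l; rewrite Ll.
case: (ex_minnP ex2) => l2 /andP[L2 lt12] min2.
have m2 k : L k -> l1 < k -> l2 <= k by move=> Lk yk; apply: min2; rewrite Lk.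
have ft : first_two L y l1 l2.
  split=> // [|k Lk yk]; first by rewrite y1.
  by have := m1 k Lk yk; have := m2 k Lk; lia.
have [ll2|ll2] := ltnP l2 l.
  have [|c Fc [cl ch]] := @charged_ex y l1 l2 l; first by split.
  by exists 2, c.
exists 1, y; split=> //; split=> //=; exists l1.
by rewrite (_ : l = l2) //; have := m2 l Ll ll1; lia.
Qed.

Lemma gap_system_count N :
  size [seq l <- iota 0 N | L l] <= 3 * size [seq f <- iota 0 N | F f].
Proof.
rewrite -[3](size_iota 0) -(size_allpairs pair).
apply: (@leq_size_injective_rel _ _ (fun l b => L l /\ gap_code l b)).
- exact/filter_uniq/iota_uniq.
- move=> l; rewrite mem_filter mem_iota => /andP[Ll lN].
  have [i [c [i3 Fc cl cd]]] := gap_code_ex Ll; exists (i, c) => //.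
  apply/allpairsP; exists (i, c); split=> //; first by rewrite mem_iota.
  by rewrite mem_filter Fc mem_iota /=; lia.
- by move=> l l' b [Ll cl] [Ll' cl']; apply: gap_code_inj cl cl'.
Qed.

End Gap.

(** * From squares in a word to gap systems *)

(** If [v i < u i] and [v i = u j], then [u j <= v j] by induction on the value, but the isomorphism
    gives [v j < v i = u j]. The other inequality is dual, by induction downwards from [B]. *)
Lemma order_iso_sub_eq (u v : nat -> nat) n B :
  (forall i j, i < n -> j < n -> (u i <= u j) = (v i <= v j)) ->
  (forall i, i < n -> u i <= B) ->
  (forall i, i < n -> exists2 j, j < n & v i = u j) ->
  forall i, i < n -> u i = v i.
Proof.
move=> iso uB sub i ltin; apply/eqP; rewrite eqn_leq; apply/andP; split.
  elim/ltn_ind: {i}(u i) {-2}i (erefl (u i)) ltin => a IHa i uia ltin.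
  rewrite leqNgt; apply/negP => lt_via.
  have [j ltjn vij] := sub i ltin.
  have := IHa (u j) _ j erefl ltjn; rewrite -vij -uia => /(_ lt_via).
  have := iso i j ltin ltjn; lia.
elim/ltn_ind: {i}(B - u i) {-2}i (erefl (B - u i)) ltin => a IHa i uia ltin.
rewrite leqNgt; apply/negP => lt_via.
have [j ltjn vij] := sub i ltin.
have := IHa (B - u j) _ j erefl ltjn.
have := iso j i ltjn ltin; have := uB i ltin; have := uB j ltjn; lia.
Qed.

Definition shift_iso (s : nat -> nat) (p n : nat) : Prop :=
  forall i j, i < n -> j < n -> (s i <= s j) = (s (p + i) <= s (p + j)).

Definition first_occ (s : nat -> nat) (f : nat) : bool :=
  all (fun t => s t != s f) (iota 0 f).

Lemma first_occP s f : reflect (forall t, t < f -> s t <> s f) (first_occ s f).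
Proof.
apply: (iffP allP) => [ne t ltf|ne t]; first by apply/eqP/ne; rewrite mem_iota.
by rewrite mem_iota => /andP[_ ltf]; apply/eqP/ne.
Qed.

Lemma first_occ_ex s t : exists f, [/\ first_occ s f, f <= t & s f = s t].
Proof.
have ex_t : exists f, s f == s t by exists t.
case: (ex_minnP ex_t) => f /eqP sft fmin; exists f; split=> //; last exact: fmin.
apply/first_occP => k ltkf; rewrite sft => /eqP /fmin; lia.
Qed.

Lemma shift_iso_first_occ s p n f : shift_iso s p n -> first_occ s f ->
  p <= f < p + n -> first_occ s (f - p).
Proof.
move=> iso /first_occP ff pf; apply/first_occP => t lttf e.
apply: (ff (p + t)); first by lia.
have ltfn : f - p < n by lia.
have lttn : t < n by lia.
have := iso _ _ lttn ltfn; have := iso _ _ ltfn lttn.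
by rewrite e leqnn subnKC; lia.
Qed.

(** Both [i] and [l2 - l1 + i] are compared with [l2 + i], the former by the shift [l2], the latter
    by the shift [l1]. *)
Lemma shift_isoB s l1 l2 : l1 < l2 -> shift_iso s l1 l1 -> shift_iso s l2 l2 ->
  shift_iso s (l2 - l1) (l1 - (l2 - l1)).
Proof.
move=> lt12 iso1 iso2 i j lti ltj.
rewrite (iso2 i j); try lia.
rewrite (iso1 (l2 - l1 + i) (l2 - l1 + j)); try lia.
by rewrite !addnA subnKC // ltnW.
Qed.

(** Without a new letter at positions from [n] to [p + n - 1], the shifted fragment only uses
    letters of the original one. *)
Lemma shift_iso_no_first_occ s p n B : shift_iso s p n -> (forall t, s t <= B) ->
  (forall f, first_occ s f -> f < p + n -> f < n) ->
  forall i, i < n -> s i = s (p + i).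
Proof.
move=> iso sB new i ltin.
apply: (order_iso_sub_eq (u := s) (v := fun i => s (p + i)) (n := n) (B := B)) => //.
move=> j ltjn; have [f [ff lef e]] := first_occ_ex s (p + j).
by exists f => //; apply: new => //; lia.
Qed.

Lemma op_square_occurrenceP w i l : op_square_occurrence w i l ->
  let s t := nth 0 w (i.-1 + t) in
  [/\ 0 < l, shift_iso s l l & ~ forall t, t < l -> s t = s (l + t)].
Proof.
case/and4P => l0 i0 iw /op_squareP[u [v [xE /order_isoP[suv uv] neq]]] s.
have sx : size (fragment w i (i + 2 * l - 1)) = 2 * l.
  by rewrite /fragment size_takel ?size_drop; lia.
have su : size u = l by move: sx; rewrite xE size_cat -suv; lia.
have nthx t : t < 2 * l -> nth 0 (u ++ v) t = s t.
  by move=> tl; rewrite -xE /fragment nth_take ?nth_drop //; lia.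
have nu t : t < l -> nth 0 u t = s t.
  by move=> tl; rewrite -nthx ?nth_cat ?su ?tl //; lia.
have nv t : t < l -> nth 0 v t = s (l + t).
  move=> tl; rewrite -nthx ?nth_cat ?su; last by lia.
  by rewrite ltnNge leq_addr /= addKn.
split=> // [j k jl kl|e].
  rewrite -(nu j jl) -(nu k kl) -(nv j jl) -(nv k kl).
  by apply/idP/idP; apply uv; lia.
apply: neq; apply: (@eq_from_nth _ 0) => // t; rewrite su => tl.
by rewrite nu // nv // e.
Qed.

Lemma nth_bounded (w : seq nat) B t : all (fun a => a <= B) w -> nth 0 w t <= B.
Proof.
move=> wB; have [lt|ge] := ltnP t (size w); last by rewrite nth_default.
exact: (allP wB) _ (mem_nth 0 lt).
Qed.

Lemma occurrence_gap_system w i B : all (fun a => a <= B) w ->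
  gap_system (first_occ (fun t => nth 0 w (i.-1 + t))) (op_square_occurrence w i).
Proof.
move=> wB; set s := fun t => _.
have sB t : s t <= B by apply: nth_bounded.
have occ l := @op_square_occurrenceP w i l.
split=> //.
- by move=> l /occ[].
- move=> l /occ[l0 iso neq].
  have [/hasP[a]|/hasPn no] := boolP (has (first_occ s) (iota l l)).
    by rewrite mem_iota => la Fa; exists a => //; lia.
  case: neq; apply: (shift_iso_no_first_occ iso sB) => f ff lt.
  rewrite ltnNge; apply/negP => le; have := no f; rewrite mem_iota ff le lt.
  by move/(_ isT).
- move=> l a /occ[l0 iso neq] Fa la.
  by apply: shift_iso_first_occ iso Fa _; lia.
- move=> l1 l2 f /occ[_ iso1 _] /occ[_ iso2 _] lt12 Ff lf.
  by apply: shift_iso_first_occ (shift_isoB lt12 iso1 iso2) Ff _; lia.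
- move=> l1 l2 a /occ[_ iso1 _] /occ[_ iso2 _] lt12 Fa la.
  set p := l2 - l1; have iso := shift_isoB lt12 iso1 iso2.
  have [/hasP[f]|/hasPn no] := boolP (has (first_occ s) (iota (l1 - p) p)).
    by rewrite mem_iota => la' Fa'; exists f => //; lia.
  have /first_occP F1 : first_occ s (a - l1).
    by apply: shift_iso_first_occ iso1 Fa _; lia.
  have per t : t < l1 - p -> s t = s (p + t).
    apply: (shift_iso_no_first_occ iso sB) => f ff lt.
    rewrite ltnNge; apply/negP => le.
    by have := no f; rewrite mem_iota ff le (_ : f < _); [move/(_ isT)|lia].
  (* The period [p] takes [a - l2] to [a - l1], which therefore carries no new letter. *)
  case: (F1 (a - l2)); first by lia.
  by rewrite per; [congr s|]; lia.
Qed.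

Lemma count_first_occ s N B : (forall t, s t <= B) ->
  size [seq f <- iota 0 N | first_occ s f] <= B.+1.
Proof.
move=> sB; rewrite -[B.+1](size_iota 0).
apply: (@leq_size_injective_rel _ _ (fun f c => first_occ s f /\ s f = c)).
- exact/filter_uniq/iota_uniq.
- move=> f; rewrite mem_filter => /andP[ff _].
  by exists (s f) => //; rewrite mem_iota /= ltnS.
- move=> f f' c [/first_occP ff fc] [/first_occP ff' fc'].
  have := ff f'; have := ff' f; rewrite fc fc'.
  by case: (ltngtP f f') => // _; [move/(_ isT)/(_ erefl) | move=> _ /(_ isT)/(_ erefl)].
Qed.

(* [sigma.+1] because reading past the end of [w] yields the extra letter [0]. *)
Lemma num_op_square_occurrences_le sigma w : over_alphabet sigma w ->
  num_op_square_occurrences w <= 3 * sigma.+1 * (size w).+1.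
Proof.
move=> ow; have wB : all (fun a => a <= sigma) w.
  by apply: sub_all ow => a /andP[].
rewrite /num_op_square_occurrences -sum1_card.
under eq_bigl do rewrite inE.
rewrite -(pair_big_dep xpredT (fun i l : 'I__ => op_square_occurrence w i l)
  (fun _ _ => 1)) /=.
rewrite mulnC -[X in X * _]card_ord -sum_nat_const; apply: leq_sum => i _.
rewrite -(big_mkord (op_square_occurrence w i) (fun=> 1)) sum1_count.
rewrite -size_filter /index_iota subn0.
apply: leq_trans (gap_system_count (occurrence_gap_system i wB) _) _.
by apply: leq_mul => //; apply: count_first_occ => t; apply: nth_bounded.
Qed.

(** * Words with many distinct squares *)

(* A window of the infinite word [1^m 2^m 3^m ...]; positions count from [0]. *)
Definition stairs (m i n : nat) : seq nat := mkseq (fun t => ((i + t) %/ m).+1) n.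

Lemma stairs_cat m i n1 n2 :
  stairs m i (n1 + n2) = stairs m i n1 ++ stairs m (i + n1) n2.
Proof.
rewrite /stairs /mkseq iotaD map_cat; congr (_ ++ _).
rewrite add0n -[n1 in iota n1]addn0 iotaDl -map_comp.
by apply: eq_map => t /=; rewrite addnA.
Qed.

Lemma infix_stairs m i n N : i + n <= N -> infix (stairs m i n) (stairs m 0 N).
Proof.
move=> leN; rewrite -(subnKC leN) !stairs_cat add0n -catA.
by apply/infixP; exists (stairs m 0 i), (stairs m (i + n) (N - (i + n))).
Qed.

Lemma op_square_stairs m i k : 0 < m -> 0 < k -> op_square (stairs m i (2 * (k * m))).
Proof.
move=> m0 k0; apply/op_squareP.
exists (stairs m i (k * m)), (stairs m (i + k * m) (k * m)).
have nthE t : t < k * m -> nth 0 (stairs m (i + k * m) (k * m)) t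
    = k + nth 0 (stairs m i (k * m)) t.
  by move=> lt; rewrite !nth_mkseq // addnAC addnC divnMDl // addnS.
split; first by rewrite mul2n -addnn stairs_cat.
  apply/order_isoP; rewrite !size_mkseq; split=> // a b lta ltb.
  by rewrite !nthE // leq_add2l.
move=> e; have := nthE 0; rewrite -e muln_gt0 k0 m0 => /(_ isT); lia.
Qed.

(** The length gives [k], the first letter gives [i %/ m], and the first change of letter gives
    [i %% m]. *)
Lemma stairs_inj m i k i' k' : 0 < m -> 0 < k ->
  stairs m i (2 * (k * m)) = stairs m i' (2 * (k' * m)) -> (i, k) = (i', k').
Proof.
move=> m0; wlog lt : i k i' k' / i <= i' => [hw|] k0 e.
  case: (leqP i i') => [le|/ltnW le]; first exact: hw.
  symmetry; apply: (hw) => //.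
  by have := congr1 size e; rewrite !size_mkseq; nia.
have := congr1 size e; rewrite !size_mkseq => ek.
have {ek} ek : k' = k by nia.
rewrite ek in e *; congr pair.
have nE t : t < 2 * (k * m) -> (i + t) %/ m = (i' + t) %/ m.
  by move=> tl; have := congr1 (fun s => nth 0 s t) e; rewrite !nth_mkseq // => -[].
have e0 := nE 0; rewrite !addn0 in e0.
(* The offset at which the second window first changes letter; if [i < i'], the first window has not
   changed yet. *)
have e1 := nE (m - i' %% m).
have lt1 : i' %% m < m by rewrite ltn_mod.
have lt2 : i %% m < m by rewrite ltn_mod.
have d1 := divn_eq i m; have d2 := divn_eq i' m.
have {}e0 : i %/ m = i' %/ m by apply: e0; nia.
have {e1} : (i + (m - i' %% m)) %/ m = (i' + (m - i' %% m)) %/ m by apply: e1; nia.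
rewrite (_ : i' + _ = (i' %/ m).+1 * m); last by nia.
rewrite mulnK // => e1.
have := leq_trunc_div (i + (m - i' %% m)) m; rewrite e1; nia.
Qed.

(** Starts below [q * m] and lengths at most [2 * q * m] fit into [3 * q * m]. *)
Lemma many_op_squares_stairs q m N : 0 < m -> 3 * q * m <= N ->
  exists X : seq (seq nat), [/\ uniq X, size X = q * m * q &
    forall x, x \in X -> op_square x /\ infix x (stairs m 0 N)].
Proof.
move=> m0 leN.
pose X := [seq stairs m i (2 * (k * m)) | i <- iota 0 (q * m), k <- iota 1 q].
exists X; split; last 1 first.
- move=> x /allpairsP[[i k] /= []]; rewrite !mem_iota => ib kb ->.
  by split; [apply: op_square_stairs => //; lia | apply: infix_stairs; nia].
- apply: allpairs_uniq; try exact: iota_uniq.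
  move=> [i k] [i' k'] /allpairsP[[i1 k1] /= [_ + [-> ->]]] _.
  rewrite mem_iota => k0; apply: stairs_inj => //; lia.
- by rewrite size_allpairs !size_iota.
Qed.

Lemma op_square_nseq x a b : 0 < x -> a != b -> op_square (nseq x a ++ nseq x b).
Proof.
move=> x0 ab; apply/op_squareP; exists (nseq x a), (nseq x b); split=> //.
  apply/order_isoP; rewrite !size_nseq; split=> // i j ix jx.
  by rewrite !nth_nseq ix jx !leqnn.
by case: x x0 => // x _ [/eqP]; rewrite (negPf ab).
Qed.

Lemma many_op_squares_binary m (w := nseq m 1 ++ nseq m 2) :
  exists X : seq (seq nat), [/\ uniq X, size X = m &
    forall x, x \in X -> op_square x /\ infix x w].
Proof.
exists [seq nseq x 1 ++ nseq x 2 | x <- iota 1 m]; split.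
- rewrite map_inj_in_uniq ?iota_uniq // => x y _ _ /(congr1 size).
  by rewrite !size_cat !size_nseq; lia.
- by rewrite size_map size_iota.
- move=> _ /mapP[x + ->]; rewrite mem_iota => xb; split.
    by apply: op_square_nseq => //; lia.
  apply/infixP; exists (nseq (m - x) 1), (nseq (m - x) 2).
  rewrite catA catA -nseqD -catA -nseqD /w; congr (nseq _ _ ++ nseq _ _); lia.
Qed.

Import Order.TTheory GRing.Theory Num.Theory.
Local Open Scope ring_scope.

Theorem theorem1 (R : realFieldType) :
  (exists C : R, 0 < C /\
     forall (sigma n : nat) (w : seq nat),
       (1 <= sigma)%N -> (1 <= n)%N -> size w = n -> over_alphabet sigma w ->
       (num_op_square_occurrences w)%:R <= C * sigma%:R * n%:R)
  /\
  (exists c : R, 0 < c /\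
     forall sigma : nat, (2 <= sigma)%N ->
     forall N : nat, exists (n : nat) (w : seq nat),
       [/\ (N <= n)%N, size w = n, over_alphabet sigma w
         & exists X : seq (seq nat),
             [/\ uniq X,
                 (forall x, x \in X -> op_square x /\ infix x w)
               & c * sigma%:R * n%:R <= (size X)%:R]]).
Proof.
split.
  (* [3 * (sigma + 1) * (n + 1) <= 3 * (2 * sigma) * (2 * n)]. *)
  exists 12%:R; split=> [|sigma n w s1 n1 sw ow]; first by rewrite ltr0n.
  rewrite -!natrM ler_nat; apply: leq_trans (num_op_square_occurrences_le ow) _.
  by rewrite sw; nia.
(* With [q = sigma %/ 3] and [sigma >= 3] one has [sigma <= 5 * q], the worst case being
   [sigma = 5]; 25 is the square of this 5. *)
exists 25%:R^-1; split=> [|sigma sigma2 N]; first by rewrite invr_gt0 ltr0n.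
have bound (n k : nat) : (sigma * n <= 25 * k)%N ->
    25%:R^-1 * sigma%:R * n%:R <= k%:R :> R.
  move=> le; rewrite -mulrA -natrM mulrC ler_pdivrMr ?ltr0n //.
  by rewrite -natrM ler_nat (mulnC k).
have [s3|s2] := leqP 3 sigma.
  have m0 : (0 < N.+1)%N by [].
  pose q := (sigma %/ 3)%N.
  have q3 : (3 * q <= sigma)%N by rewrite /q; lia.
  have [|X [uX sX XP]] := @many_op_squares_stairs q N.+1 (sigma * N.+1) m0.
    by rewrite leq_mul2r q3 orbT.
  exists (sigma * N.+1)%N, (stairs N.+1 0 (sigma * N.+1)); split.
  - by nia.
  - by rewrite size_mkseq.
  - apply/allP => _ /mapP[t + ->]; rewrite mem_iota add0n /= => tb.
    by rewrite ltn_divLR.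
  - exists X; split=> //; apply: bound; rewrite sX.
    have q5 : (sigma <= 5 * q)%N by rewrite /q; lia.
    rewrite mulnA (_ : 25 * _ = 5 * q * (5 * q) * N.+1)%N; last by lia.
    by rewrite leq_mul2r leq_mul ?orbT.
have [X [uX sX XP]] := many_op_squares_binary N.
exists (N + N)%N, (nseq N 1%N ++ nseq N 2); split.
- by lia.
- by rewrite size_cat !size_nseq.
- by rewrite /over_alphabet all_cat !all_nseq /= sigma2 (ltnW sigma2) !orbT.
- by exists X; split=> //; apply: bound; rewrite sX; nia.
Qed.
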